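(* Let $\pi:X\to Y$ be a finite ramified covering of smooth projective varieties and let $\Delta(R)$ be the collection of reduced irreducible components of the ramification locus. If $\underline{a}$ is a monomial exponent for $\Delta(R)$ which is not multiplicity free and $|\hat{\underline{a}}|\ge1$, then $$\delta_{\underline{a}}(E_{R^{\underline{a}}}-1)+\sum_{\underline{a}'\le\hat{\underline{a}},\ |\underline{a}'|\ge1}(-\lambda_{\underline{a}-\underline{a}'}\,\delta_{\underline{a}'})(E_{R^{\underline{a}'}}-1)=\delta_{\underline{a}}\,(E_{R^{\underline{a}}}-E_{R^{\hat{\underline{a}}}}).$$
   Context: The ''ramification locus'' is by convention $\pi^{-1}(B)$ with $B$ the branch locus, so $\Delta(R)=\{R_i\}$ is the set of all reduced irreducible components of $\pi^{-1}(B)$, even those along which $\pi$ is unramified. $e_{R_i}$ is the ramification degree of $\pi$ along $R_i$, i.e. the length of $\mathcal{O}_{X,R_i}/J_{\pi(R_i)}\mathcal{O}_{X,R_i}$ with $J_{\pi(R_i)}$ the ideal of $\pi(R_i)$. For a finite collection of divisors $\Delta=\{D_i\}$, a monomial exponent is a vector $\underline{b}=(b_i)$ of non-negative integers indexed by $\Delta$; $|\underline{b}|=\sum_i b_i$, $D^{\underline{b}}=\prod_iD_i^{b_i}$, and $\underline{b}'\le\underline{b}$ means componentwise. The support of $\underline{b}$ is $\{D_i:b_i\neq0\}$. $\underline{b}$ is multiplicity free (MF) if all $b_i\le1$, NMF (not multiplicity free) otherwise. $\hat{\underline{b}}$ is the exponent with $\hat b_i=1$ if $b_i=1$ and $\hat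 b_i=0$ otherwise. For $\Delta(R)$ write $R^{\underline{a}}=\prod_iR_i^{a_i}$ and $E_{R^{\underline{a}}}=\prod_i(e_{R_i})^{a_i}$. $\delta_{\underline{b}}$ is the coefficient of the monomial $D^{\underline{b}}$ in $\prod_{D\in\Delta}\frac{D}{1-e^{-D}}$ (the $D$ being treated as formal variables). Further, $$\lambda_{\underline{b}}=\sum_{k\ge0}(-1)^{k+1}\sum_{(\underline{b}_1,\dots,\underline{b}_k)}\prod_{j=1}^k\delta_{\underline{b}_j},$$ the inner sum being over ordered tuples of monomial exponents with $\sum_j\underline{b}_j=\underline{b}$, all $|\underline{b}_j|\ge1$, pairwise disjoint supports, and $\underline{b}_1,\dots,\underline{b}_{k-1}$ MF (only $\underline{b}_k$ may be NMF). *)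

(* Defs.v *)
From HB Require Import structures.
From mathcomp Require Import all_boot all_order all_algebra.
From mathcomp Require Import boolp classical_sets.
From mathcomp Require Import mpoly.

Set Implicit Arguments.
Unset Strict Implicit.
Unset Printing Implicit Defensive.

Import Order.TTheory GRing.Theory Num.Theory.

Local Open Scope classical_set_scope.
Local Open Scope ring_scope.

(** * Varieties

    An integral separated scheme is determined by the set of its local rings,
    all of them subrings of its function field (the "schémas de Chevalley" of
    EGA I, 8).  Varieties over a field [k] are represented in this way: a point
    *is* its local ring, a subset of the function field; the local rings of an
    affine open [Spec A] are the localizations of [A] at its prime ideals; a
    point [x'] is a generization of [x] (that is, [x] lies in the closure of
    [x']) iff [x `<=` x'] as subsets of the function field; and the irreducible
    closed subsets are the closures of the points, so that an irreducible
    closed subset is given by its generic point. *)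

Section Subrings.
Context (K : fieldType).
Implicit Types (A I O p : set K).

Definition is_subring A :=
  [/\ A 1, (forall a b, A a -> A b -> A (a - b)) &
      (forall a b, A a -> A b -> A (a * b))].

Definition is_ideal A I :=
  [/\ I `<=` A, I 0, (forall a b, I a -> I b -> I (a + b)) &
      (forall a b, A a -> I b -> I (a * b))].

Definition is_prime_ideal A p :=
  [/\ is_ideal A p, ~ p 1 &
      (forall a b, A a -> A b -> p (a * b) -> p a \/ p b)].

Definition localization A p : set K :=
  [set z | exists a s, [/\ A a, A s, ~ p s & z = a / s]].

Definition spec A : set (set K) :=
  [set O | exists2 p, is_prime_ideal A p & O = localization A p].

Definition is_unit O (z : K) := [/\ O z, z != 0 & O z^-1].

Definition max_ideal O : set K := [set z | O z /\ ~ is_unit O z].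

(* The length of the [O]-module [O / I], as the maximal length of a strictly
   increasing chain of submodules, i.e. of ideals of [O] containing [I]. *)
Definition ideal_chain O I (m : nat) (c : nat -> set K) :=
  (forall j, (j <= m)%N -> is_ideal O (c j) /\ I `<=` c j) /\
  (forall j, (j < m)%N -> c j `<` c j.+1).

Definition has_quotient_length O I (l : nat) :=
  (exists c, ideal_chain O I l c) /\
  (forall m c, ideal_chain O I m c -> (m <= l)%N).

End Subrings.

(* [k[t_1, ..., t_m]], where [k] is embedded in [K] by [iota]. *)
Definition generated_algebra (k K : fieldType) (iota : {rmorphism k -> K})
    (m : nat) (t : 'I_m -> K) : set K :=
  [set z | exists f : {mpoly k[m]}, z = mmap iota t f].

(* An integral closed subscheme of [P^N_k], given by its function field and its
   generic point [(x_0 : ... : x_N)]; [x_j = 0] iff it is contained in the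
   hyperplane [X_j = 0]. *)
Record proj_variety (k : fieldType) := ProjVariety {
  ambient_dim : nat;
  funfield : fieldType;
  const : {rmorphism k -> funfield};
  coord : 'I_ambient_dim.+1 -> funfield;
  coord_neq0 : exists i, coord i != 0;
  (* the function field is the field of fractions of the coordinate ring
     [k[x_0/x_i, ..., x_N/x_i]] of the open set [X_i <> 0] *)
  funfieldP : forall i, coord i != 0 -> forall z, exists a b,
    [/\ generated_algebra const (fun j => coord j / coord i) a,
        generated_algebra const (fun j => coord j / coord i) b,
        b != 0 & z = a / b]
}.

Section Variety.
Context (k : fieldType) (X : proj_variety k).

Definition chart (i : 'I_(ambient_dim X).+1) : set (funfield X) :=
  generated_algebra (@const k X) (fun j => coord j / coord i).

Definition points : set (set (funfield X)) :=
  [set x | exists2 i, @coord k X i != 0 & spec (chart i) x].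

(* [x] is smooth over [k] when its local ring is a localization of a standard
   smooth algebra: it is the localization at a prime of
   [k[t_1, ..., t_m] = k[T_1, ..., T_m] / P], where near [x] the ideal [P] is
   generated by [f_1, ..., f_c] and a [c]-minor of the Jacobian matrix of the
   [f_i] is invertible at [x]. *)
Definition smooth_at (x : set (funfield X)) :=
  exists (m c : nat) (t : 'I_m -> funfield X) (f : 'I_c -> {mpoly k[m]})
         (sigma : 'I_c -> 'I_m),
    let ev := mmap (@const k X) t in
    [/\ spec (generated_algebra (@const k X) t) x,
        (forall i, ev (f i) = 0),
        is_unit x (\det (\matrix_(i < c, j < c) ev ((f i)^`M(sigma j)))) &
        (forall g, ev g = 0 -> exists (s : {mpoly k[m]}) (h : 'I_c -> {mpoly k[m]}),
           is_unit x (ev s) /\ s * g = \sum_(i < c) h i * f i)].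

Definition smooth := forall x, points x -> smooth_at x.

End Variety.

(** * Finite coverings *)

(* The local ring [x] dominates the local ring [y] along [phi]. *)
Definition dominates (K L : fieldType) (phi : {rmorphism L -> K})
    (x : set K) (y : set L) :=
  phi @` y `<=` x /\ phi @` max_ideal y `<=` max_ideal x.

(* A dominant morphism [X -> Y] is given by the map it induces on function
   fields; a point [x] is sent to the unique point [y] whose local ring is
   dominated by the local ring of [x].  It is finite when [Y] is covered by
   affine opens [Spec A] whose inverse image is some [Spec B] with [B] a finitely
   generated [A]-module.  A finite dominant morphism is surjective. *)
Record finite_covering (k : fieldType) (X Y : proj_variety k) := FiniteCovering {
  pullback : {rmorphism funfield Y -> funfield X};
  pullback_const : forall c, pullback (const Y c) = const X c;
  pullback_morphism : forall x, @points k X x ->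
    exists2 y, @points k Y y & dominates pullback x y;
  pullback_finite : forall y, @points k Y y ->
    exists (m : nat) (t : 'I_m -> funfield Y) (r : nat) (b : 'I_r -> funfield X),
      let A := generated_algebra (const Y) t in
      let B := [set z | exists2 a : 'I_r -> funfield Y, (forall j, A (a j)) &
                          z = \sum_(j < r) pullback (a j) * b j] in
      [/\ spec A `<=` @points k Y, spec A y, is_subring B &
          spec B = [set x | @points k X x /\
                            exists2 y', spec A y' & dominates pullback x y']]
}.

Section Ramification.
Context (k : fieldType) (X Y : proj_variety k) (pi : finite_covering X Y).

Definition maps_to (x : set (funfield X)) (y : set (funfield Y)) :=
  [/\ @points k X x, @points k Y y & dominates (pullback pi) x y].

(* The ideal generated in [x] by the image of the maximal ideal of [y]. *)
Definition extended_ideal (x : set (funfield X)) (y : set (funfield Y)) :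
    set (funfield X) :=
  [set z | exists (r : nat) (u : 'I_r -> funfield X) (v : 'I_r -> funfield Y),
     [/\ (forall j, x (u j)), (forall j, max_ideal y (v j)) &
         z = \sum_(j < r) u j * pullback pi (v j)]].

(* Every element of the residue field of [x] is a simple root of a polynomial
   over the residue field of [y]. *)
Definition residually_separable (x : set (funfield X)) (y : set (funfield Y)) :=
  forall u, x u -> exists p : {poly funfield Y},
    [/\ (forall i, y p`_i), max_ideal x (map_poly (pullback pi) p).[u] &
        ~ max_ideal x (map_poly (pullback pi) p^`()).[u]].

Definition unramified_at (x : set (funfield X)) (y : set (funfield Y)) :=
  extended_ideal x y = max_ideal x /\ residually_separable x y.

Definition branch_locus : set (set (funfield Y)) :=
  [set y | exists2 x, maps_to x y & ~ unramified_at x y].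

(* By convention, the whole inverse image of the branch locus. *)
Definition ramification_locus : set (set (funfield X)) :=
  [set x | exists2 y, branch_locus y & maps_to x y].

(* The irreducible components of the ramification locus, each of them given by
   (the local ring of [X] at) its generic point. *)
Definition ramification_components : set (set (funfield X)) :=
  [set x | ramification_locus x /\
           forall x', ramification_locus x' -> x `<=` x' -> x' = x].

(* [e] is the length of [O_{X,R} / J O_{X,R}], [J] being the ideal of [pi(R)]. *)
Definition ramification_degree (R : set (funfield X)) (e : nat) :=
  exists2 y, maps_to R y & has_quotient_length R (extended_ideal R y) e.

End Ramification.

(** * Monomial exponents *)

Section Exponents.
Context (n : nat).
Implicit Types (b : 'X_{1..n}).

Definition expo_support b : {set 'I_n} := [set i | b i != 0%N].

Definition mult_free b : bool := [forall i, b i <= 1]%N.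

Definition expo_hat b : 'X_{1..n} := [multinom (b i == 1%N) : nat | i < n].

End Exponents.

(** * Formal power series in [n] variables, and the Todd series *)

Definition fps (n : nat) := 'X_{1..n} -> rat.

Definition fps_one (n : nat) : fps n := fun b => (b == 0%MM)%:R.

Definition fps_mul (n : nat) (F G : fps n) : fps n := fun b =>
  \sum_(c : 'X_{1..n < (mdeg b).+1} | (c <= b)%MM) F c * G (b - c)%MM.

(* The series [\sum_k s_k D_i^k] in the single variable [D_i]. *)
Definition fps_in_var (n : nat) (i : 'I_n) (s : nat -> rat) : fps n := fun b =>
  if b == (U_(i) *+ b i)%MM then s (b i) else 0.

(* The first [m] coefficients of the inverse of [\sum_j s_j D^j], [s_0 <> 0]. *)
Fixpoint series_inv_seq (s : nat -> rat) (m : nat) : seq rat :=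
  if m is m'.+1 then
    let r := series_inv_seq s m' in
    rcons r ((s 0%N)^-1 * ((m' == 0%N)%:R - \sum_(j < m') s (m' - j)%N * r`_j))
  else [::].

Definition series_inv (s : nat -> rat) (m : nat) : rat :=
  (series_inv_seq s m.+1)`_m.

(* [1 - exp(-D)] and its quotient by [D]. *)
Definition one_sub_exp_neg (m : nat) : rat :=
  (m == 0%N)%:R - (-1) ^+ m / m`!%:R.

Definition one_sub_exp_neg_div (m : nat) : rat := one_sub_exp_neg m.+1.

(* [D / (1 - exp(-D))] *)
Definition todd_series : nat -> rat := series_inv one_sub_exp_neg_div.

Section SeriesInv.
Variable s : nat -> rat.

Lemma size_series_inv_seq m : size (series_inv_seq s m) = m.
Proof. by elim: m => //= m IH; rewrite size_rcons IH. Qed.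

Lemma nth_series_inv_seq m j : (j < m)%N -> (series_inv_seq s m)`_j = series_inv s j.
Proof.
rewrite /series_inv; elim: m => // m IH; rewrite ltnS leq_eqVlt => /orP[/eqP->//|jm].
by rewrite /= nth_rcons size_series_inv_seq jm IH.
Qed.

Lemma series_invE m : s 0%N != 0 ->
  \sum_(j < m.+1) s (m - j)%N * series_inv s j = (m == 0%N)%:R.
Proof.
move=> s0; rewrite big_ord_recr /= subnn {2}/series_inv /= nth_rcons.
rewrite size_series_inv_seq ltnn eqxx mulrA divff // mul1r.
under [X in _ - X]eq_bigr => j _ do rewrite nth_series_inv_seq //.
by rewrite addrC subrK.
Qed.

End SeriesInv.

Lemma todd_seriesE m :
  \sum_(j < m.+1) one_sub_exp_neg (m - j)%N * todd_series j = (m == 1%N)%:R.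
Proof.
have one0 : one_sub_exp_neg 0 = 0 by rewrite /one_sub_exp_neg fact0 divr1 subrr.
rewrite big_ord_recr /= subnn one0 mul0r addr0.
case: m => [|m]; first by rewrite big_ord0.
rewrite -[RHS]/((m == 0%N)%:R) -(@series_invE one_sub_exp_neg_div) //.
by apply: eq_bigr => j _; rewrite /one_sub_exp_neg_div -subSn // -ltnS.
Qed.

(** * The coefficients [delta] and [lambda] *)

Section Coefficients.
Context (n : nat).
Implicit Types (b : 'X_{1..n}).

Definition delta b : rat :=
  (\big[@fps_mul n/@fps_one n]_(i < n) fps_in_var i todd_series) b.

Definition lambda_tuple b (k : nat)
    (T : {ffun 'I_k -> 'X_{1..n < (mdeg b).+1}}) : bool :=
  [&& (\sum_(j < k) (T j : 'X_{1..n}))%MM == b,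
      [forall j, 1 <= mdeg (T j)]%N,
      [forall j1, forall j2, (j1 != j2) ==>
         [disjoint expo_support (T j1) & expo_support (T j2)]] &
      [forall j : 'I_k, (j.+1 < k)%N ==> mult_free (T j)]].

(* There is no admissible tuple of length [k > |b|], the [k] members having
   degree at least 1 and sum [b]; their degrees are at most [|b|]. *)
Definition lambda b : rat :=
  \sum_(k < (mdeg b).+1) (-1) ^+ k.+1 *
    \sum_(T : {ffun 'I_k -> 'X_{1..n < (mdeg b).+1}} | lambda_tuple T)
      \prod_(j < k) delta (T j).

(* [E_{R^a}] *)
Definition ram_monomial (e : 'I_n -> nat) b : nat := (\prod_(i < n) e i ^ b i)%N.

End Coefficients.

(* Main.v *)
Require Import Defs.
From mathcomp Require Import all_boot all_order all_algebra.
From mathcomp Require Import boolp classical_sets.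
From mathcomp Require Import mpoly.
From mathcomp Require Import zify ring.

(* The coefficient [delta] is multiplicative over exponents with disjoint
   supports, so every admissible tuple contributes [delta b] to [lambda b] up to
   sign, and [lambda b = delta b * \sum_k (-1)^(k+1) N_k] with [N_k] the number of
   admissible [k]-tuples.  When [b] is NMF, the last member of an admissible tuple
   is NMF; splitting off its multiplicity-free part is a bijection from the
   [k]-tuples whose last member has a nonzero hat to the [k+1]-tuples whose last
   member has zero hat.  The alternating sum telescopes and leaves only the
   [1]-tuples of the second kind: [lambda b] is [delta b] if [hat b = 0] and [0]
   otherwise.  Hence only [a' = hat a] contributes to the sum in the theorem. *)

Import Order.TTheory GRing.Theory Num.Theory.
Local Open Scope classical_set_scope.
Local Open Scope ring_scope.

(** * Todd coefficients and the product formula for [delta] *)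

Lemma todd_series0 : todd_series 0 = 1.
Proof.
(* The series [1 - exp(-D)] has constant term 0 and linear coefficient 1, so its relation in degree
   1 isolates [todd_series 0]. *)
have := todd_seriesE 1; rewrite !big_ord_recl big_ord0 /=.
rewrite /bump /= /one_sub_exp_neg /=.
by rewrite expr1 fact0 !divr1 subrr mul0r sub0r opprK mul1r !addr0.
Qed.

(** A nonzero term of the convolution needs [c] to be a power of [D_i] and [b - c] to be free of
    [D_i], which forces [c = U_(i) *+ b i]. *)
Lemma fps_in_var_mulE {n} (i : 'I_n) (s : nat -> rat) (G : fps n) (b : 'X_{1..n}) :
  (forall c : 'X_{1..n}, c i != 0%N -> G c = 0) ->
  fps_mul (fps_in_var i s) G b = s (b i) * G (b - U_(i) *+ b i)%MM.
Proof.
move=> G0; have le_c0 : (U_(i) *+ b i <= b)%MM.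
  apply/mnm_lepP => l; rewrite mulmnE mnm1E.
  by case: eqP => [->|_]; rewrite ?mul1n ?mul0n.
have c0_lt : (mdeg (U_(i) *+ b i) < (mdeg b).+1)%N.
  rewrite ltnS !mdegE; apply: leq_sum => l _; exact: (mnm_lepP le_c0).
rewrite /fps_mul (bigD1 (BMultinom c0_lt)) //= big1 ?addr0.
  by rewrite /fps_in_var mulmnE mnm1E eqxx mul1n eqxx.
move=> c /andP[c_le c_neq]; rewrite /fps_in_var; case: eqP => [cE|_]; last by rewrite mul0r.
rewrite G0 ?mulr0 // mnmBE subn_eq0 -ltnNge ltn_neqAle (mnm_lepP c_le) andbT.
by apply: contra c_neq => /eqP ci; rewrite -val_eqE /= cE ci.
Qed.

(** A duplicate-free list allows induction: the product over the tail does not involve the head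
    variable, so [fps_in_var_mulE] applies. *)
Lemma fps_prod_in_varE {n} (s : nat -> rat) (r : seq 'I_n) (b : 'X_{1..n}) : s 0%N = 1 ->
  uniq r ->
  (\big[@fps_mul n/@fps_one n]_(i <- r) fps_in_var i s) b =
  if [forall i, (i \in r) || (b i == 0%N)] then \prod_(i <- r) s (b i) else 0.
Proof.
move=> s0; elim: r b => [|i r IH] b /=.
  rewrite !big_nil /fps_one => _.
  have -> : [forall i, (i \in [::]) || (b i == 0%N)] = (b == 0%MM).
    apply/forallP/eqP => [b0|->] => [|i]; last by rewrite mnm0E.
    by apply/mnmP => i; have /eqP -> := b0 i; rewrite mnm0E.
  by case: eqP.
move=> /andP[i_r r_uniq]; rewrite !big_cons fps_in_var_mulE => [|c ci]; last first.
  rewrite IH //; case: forallP => // /(_ i); by rewrite (negPf i_r) (negPf ci).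
have cE l : (b - U_(i) *+ b i)%MM l = if l == i then 0%N else b l.
  rewrite mnmBE mulmnE mnm1E eq_sym.
  by case: eqP => [->|_]; rewrite ?mul1n ?mul0n ?subnn ?subn0.
rewrite IH //; set P := [forall l, _]; set Q := [forall l, _].
have -> : P = Q.
  apply: eq_forallb => l; rewrite cE inE; case: (l =P i) => //= _; exact: orbT.
case: ifP => _; rewrite ?mulr0 //; congr (_ * _).
rewrite !big_seq; apply: eq_bigr => l l_r; rewrite cE.
by case: eqP l_r i_r => // -> ->.
Qed.

Lemma deltaE {n} (b : 'X_{1..n}) : delta b = \prod_(i < n) todd_series (b i).
Proof.
rewrite /delta fps_prod_in_varE ?todd_series0 ?index_enum_uniq //.
by rewrite ifT //; apply/forallP => i; rewrite mem_index_enum.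
Qed.

(** * Hats and multiplicity-free exponents *)

Lemma expo_hatE {n} (b : 'X_{1..n}) i : expo_hat b i = (b i == 1%N).
Proof. by rewrite /expo_hat mnmE. Qed.

Lemma expo_hat_le {n} (b : 'X_{1..n}) : (expo_hat b <= b)%MM.
Proof. by apply/mnm_lepP => i; rewrite expo_hatE; case: eqP => [->|]. Qed.

Lemma expo_hat_subr {n} (b : 'X_{1..n}) : expo_hat (b - expo_hat b)%MM = 0%MM.
Proof. by apply/mnmP => i; rewrite expo_hatE mnmBE expo_hatE mnm0E; lia. Qed.

(** Each coordinate of [b] lies entirely in one of the two exponents; the other contributes
    [todd_series 0 = 1]. *)
Lemma delta_hat {n} (b : 'X_{1..n}) :
  delta (b - expo_hat b)%MM * delta (expo_hat b) = delta b.
Proof.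
rewrite !deltaE -big_split; move: todd_series todd_series0 => t t0.
apply: eq_bigr => i _ /=; rewrite mnmBE expo_hatE.
by case: eqP => [->|_]; rewrite ?subnn ?subn0 t0 ?mul1r ?mulr1.
Qed.

Lemma mult_freePn {n} (b : 'X_{1..n}) :
  reflect (exists i, 1 < b i)%N (~~ mult_free b).
Proof.
rewrite negb_forall; apply: (iffP existsP) => -[i bi]; exists i.
  by rewrite ltnNge.
by rewrite -ltnNge.
Qed.

Lemma mnm_neq0P {n} (b : 'X_{1..n}) : reflect (exists i, b i != 0%N) (b != 0%MM).
Proof.
apply: (iffP idP) => [b0|[i bi]]; last by apply: contraNneq bi => ->; rewrite mnm0E.
apply/existsP; apply: contraNT b0; rewrite negb_exists => /forallP b0.
by apply/eqP/mnmP => i; rewrite mnm0E; apply/eqP; have := b0 i; rewrite negbK.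
Qed.

(** * Admissible tuples *)

Definition admissible {n} (b : 'X_{1..n}) {k} (T : 'I_k -> 'X_{1..n}) :=
  [/\ forall i, (\sum_(j < k) T j i)%N = b i,
      forall j, T j != 0%MM,
      forall i j1 j2, j1 != j2 -> T j1 i = 0%N \/ T j2 i = 0%N &
      forall j : 'I_k, (j.+1 < k)%N -> forall i, (T j i <= 1)%N].

(** Coordinatewise conditions on exponents without a degree bound let members be split and added
    freely, and reduce most checks to linear arithmetic. *)
Lemma lambda_tupleP {n} (b : 'X_{1..n}) {k}
    (T : {ffun 'I_k -> 'X_{1..n < (mdeg b).+1}}) :
  reflect (admissible b (fun j => T j : 'X_{1..n})) (lambda_tuple T).
Proof.
apply: (iffP and4P) => [[/eqP sT /forallP T0 /forallP dT /forallP mT]|[sT T0 dT mT]].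
  split.
  - by move=> i; rewrite -[in RHS]sT mnm_sumE.
  - by move=> j; rewrite -mdeg_eq0 -lt0n.
  - move=> i j1 j2 j12; have /implyP/(_ j12) := forallP (dT j1) j2.
    rewrite disjoint_subset => /fintype.subsetP/(_ i); rewrite !inE.
    by case: eqP => [->|_ /(_ isT)]; [left|rewrite negbK => /eqP; right].
  - by move=> j jk i; have /implyP/(_ jk)/forallP := mT j.
split.
- by apply/eqP/mnmP => i; rewrite mnm_sumE.
- by apply/forallP => j; rewrite lt0n mdeg_eq0.
- apply/forallP => j1; apply/forallP => j2; apply/implyP => j12.
  rewrite disjoint_subset; apply/fintype.subsetP => i; rewrite !inE negbK.
  by case: (dT i _ _ j12) => ->.
- by apply/forallP => j; apply/implyP => jk; apply/forallP => i; exact: mT.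
Qed.

Section Admissible.
Context {n : nat} {b : 'X_{1..n}} {k : nat} {T : 'I_k -> 'X_{1..n}}.
Hypothesis admT : admissible b T.

(** Disjointness of supports kills all other summands of [b i]. *)
Lemma admissible_coord i j : T j i != 0%N -> T j i = b i.
Proof.
have [sT _ dT _] := admT => Tji; rewrite -sT (bigD1 j) //= big1 ?addn0 // => j' j'j.
by have [//|Tj0] := dT i _ _ j'j; rewrite Tj0 in Tji.
Qed.

Lemma admissible_le j : (T j <= b)%MM.
Proof.
by apply/mnm_lepP => i; have [->|/admissible_coord->] := eqVneq (T j i) 0%N.
Qed.

Lemma admissible_mdeg j : (mdeg (T j) < (mdeg b).+1)%N.
Proof.
rewrite ltnS !mdegE; apply: leq_sum => i _; exact: (mnm_lepP (admissible_le j)).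
Qed.

Lemma admissible_size : (k <= mdeg b)%N.
Proof.
have [sT T0 _ _] := admT.
have -> : mdeg b = (\sum_(j < k) mdeg (T j))%N.
  under eq_bigr do rewrite mdegE; rewrite exchange_big mdegE /=.
  by apply: eq_bigr => i _; rewrite sT.
rewrite -[X in (X <= _)%N]card_ord -sum1_card; apply: leq_sum => j _.
by rewrite lt0n mdeg_eq0.
Qed.

(** Every coordinate is carried by at most one member; the others contribute the Todd coefficient 1
    there. *)
Lemma admissible_delta : \prod_(j < k) delta (T j) = delta b.
Proof.
have [sT _ dT _] := admT.
under eq_bigr do rewrite deltaE; rewrite exchange_big deltaE.
move: todd_series todd_series0 => t t0.
apply: eq_bigr => i _; have [j Tj|T0] := pickP (fun j => T j i != 0%N).
  rewrite (bigD1 j) //= big1; first by rewrite mulr1 (admissible_coord i j Tj).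
  move=> j' j'j; have [->|Tj0] := dT i _ _ j'j; first exact: t0.
  by rewrite Tj0 in Tj.
have Ti0 j : T j i = 0%N by apply/eqP/negbFE/T0.
by rewrite -sT !big1 // => j _; rewrite Ti0.
Qed.

End Admissible.

(** A coordinate belongs to a single member, and only the last one may have an exponent above 1. *)
Lemma admissible_last {n} {b : 'X_{1..n}} {k} {T : 'I_k.+1 -> 'X_{1..n}} i :
  admissible b T -> (1 < b i)%N -> T ord_max i = b i.
Proof.
move=> admT bi; have [sT _ _ mT] := admT.
have [j Tj|T0] := pickP (fun j => T j i != 0%N); last first.
  by move: bi; rewrite -sT big1 // => j _; apply/eqP/negbFE/T0.
have := admissible_coord admT _ _ Tj; have [->//|jmax] := eqVneq j ord_max.
have jk : (j.+1 < k.+1)%N.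
  by have := ltn_ord j; move: jmax; rewrite -val_eqE /=; lia.
by move=> Tji; have := mT j jk i; rewrite Tji; lia.
Qed.

(** * Splitting and merging the last member *)

Lemma sum_lift_max (k : nat) (F : 'I_k.+1 -> nat) :
  (\sum_(j < k.+1) F j = \sum_(j < k) F (lift ord_max j) + F ord_max)%N.
Proof.
rewrite big_ord_recr /=; congr (_ + _)%N; apply: eq_bigr => j _; congr (F _).
by apply: val_inj; exact/esym/lift_max.
Qed.

(** The last member [t] becomes the consecutive pair [expo_hat t], [t - expo_hat t]; [lift ord_max]
    preserves the numerical index and [ord_max] is the new last place. *)
Definition split_last {n k} (T : 'I_k.+1 -> 'X_{1..n}) (j : 'I_k.+2) : 'X_{1..n} :=
  if unlift ord_max j is Some j'
  then if j' == ord_max then expo_hat (T ord_max) else T j'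
  else (T ord_max - expo_hat (T ord_max))%MM.

Definition merge_last {n k} (U : 'I_k.+2 -> 'X_{1..n}) (j : 'I_k.+1) : 'X_{1..n} :=
  if j == ord_max then (U (lift ord_max j) + U ord_max)%MM else U (lift ord_max j).

Lemma split_last_lift {n k} (T : 'I_k.+1 -> 'X_{1..n}) j :
  split_last T (lift ord_max j) = if j == ord_max then expo_hat (T ord_max) else T j.
Proof. by rewrite /split_last liftK. Qed.

Lemma split_last_max {n k} (T : 'I_k.+1 -> 'X_{1..n}) :
  split_last T ord_max = (T ord_max - expo_hat (T ord_max))%MM.
Proof. by rewrite /split_last unlift_none. Qed.

Lemma split_lastK {n k} (T : 'I_k.+1 -> 'X_{1..n}) : merge_last (split_last T) =1 T.
Proof.
move=> j; rewrite /merge_last split_last_lift split_last_max.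
by case: eqP => // ->; rewrite addmC submK // expo_hat_le.
Qed.

Section SplitMerge.
Context {n : nat} {b : 'X_{1..n}} {k : nat}.

Lemma admissible_split (T : 'I_k.+1 -> 'X_{1..n}) : ~~ mult_free b ->
  admissible b T -> expo_hat (T ord_max) != 0%MM -> admissible b (split_last T).
Proof.
move=> /mult_freePn[i0 bi0] admT hT; have [sT T0 dT mT] := admT; split.
- move=> i; rewrite sum_lift_max split_last_max -sT [in RHS](bigD1 ord_max) //=.
  rewrite (bigD1 ord_max) //= split_last_lift eqxx addnAC; congr (_ + _)%N.
    by rewrite mnmBE expo_hatE; lia.
  by apply: eq_bigr => j /negPf jm; rewrite split_last_lift jm.
- move=> j; case: (unliftP ord_max j) => [j' ->|->].
    by rewrite split_last_lift; case: ifP.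
  (* The new last member is nonzero: the exponent [b i0 > 1] sits in [T ord_max] and survives the
     removal of the hat. *)
  rewrite split_last_max; apply/mnm_neq0P; exists i0.
  by rewrite mnmBE expo_hatE (admissible_last _ admT bi0); lia.
- move=> i j1 j2; case: (unliftP ord_max j1) => [j1' ->|->];
    case: (unliftP ord_max j2) => [j2' ->|->]; rewrite ?eqxx //.
  + rewrite (inj_eq lift_inj) !split_last_lift => j12; have := dT i _ _ j12.
    by case: eqP => [->|_]; case: eqP => [->|_]; rewrite ?expo_hatE; lia.
  + move=> _; rewrite split_last_lift split_last_max mnmBE.
    have [_|/(dT i)] := eqVneq j1' ord_max; rewrite ?expo_hatE; lia.
  + move=> _; rewrite split_last_lift split_last_max mnmBE.
    have [_|/(dT i)] := eqVneq j2' ord_max; rewrite ?expo_hatE; lia.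
- move=> j; case: (unliftP ord_max j) => [j' ->|->] /=; last by rewrite ltnn.
  rewrite split_last_lift => _ i; case: eqP => [_|jm]; first by rewrite expo_hatE leq_b1.
  apply: mT; rewrite ltnS ltn_neqAle -ltnS (ltn_ord j') andbT.
  by apply/eqP => j'k; apply/jm/val_inj.
Qed.

(** The next-to-last member is MF and the last has no exponent 1; by disjointness, the exponents 1
    of their sum are those of the former. *)
Lemma hat_merge_last (U : 'I_k.+2 -> 'X_{1..n}) : admissible b U ->
  expo_hat (U ord_max) = 0%MM ->
  expo_hat (merge_last U ord_max) = U (lift ord_max ord_max).
Proof.
move=> [_ _ dU mU] hU; apply/mnmP => i; rewrite /merge_last eqxx expo_hatE mnmDE.
have := mU (lift ord_max ord_max); rewrite lift_max => /(_ (ltnSn _) i).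
have /mnmP/(_ i) := hU; rewrite expo_hatE mnm0E.
by have := dU i _ _ (neq_lift ord_max ord_max); lia.
Qed.

Lemma admissible_merge (U : 'I_k.+2 -> 'X_{1..n}) :
  admissible b U -> admissible b (merge_last U).
Proof.
move=> [sU U0 dU mU]; split.
- move=> i; rewrite -sU !sum_lift_max /merge_last eqxx mnmDE addnA.
  congr (_ + _ + _)%N; apply: eq_bigr => j _.
  by rewrite eq_sym (negPf (neq_lift _ _)).
- move=> j; rewrite /merge_last; case: ifP => // _.
  have /mnm_neq0P[i Ui] := U0 (lift ord_max j); apply/mnm_neq0P; exists i.
  by rewrite mnmDE addn_eq0 (negPf Ui).
- move=> i j1 j2 j12.
  have := dU i _ _ (neq_lift ord_max j1); have := dU i _ _ (neq_lift ord_max j2).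
  have := dU i (lift ord_max j1) (lift ord_max j2); rewrite (inj_eq lift_inj).
  move=> /(_ j12); rewrite /merge_last.
  case: (j1 =P ord_max) j12 => [->|_]; case: (j2 =P ord_max) => [->|_];
    rewrite ?eqxx ?mnmDE //; lia.
- move=> j jk i; rewrite /merge_last; case: eqP => [jm|_]; first by move: jk; rewrite jm /= ltnn.
  by apply: mU; rewrite lift_max; lia.
Qed.

Lemma merge_lastK (U : 'I_k.+2 -> 'X_{1..n}) : admissible b U ->
  expo_hat (U ord_max) = 0%MM -> split_last (merge_last U) =1 U.
Proof.
move=> admU hU j; case: (unliftP ord_max j) => [j' ->|->].
  rewrite split_last_lift hat_merge_last //; case: eqP => [->//|/eqP/negPf jm].
  by rewrite /merge_last jm.
by rewrite split_last_max hat_merge_last // /merge_last eqxx addmC addmK.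
Qed.

End SplitMerge.

(** * Counting tuples and the value of [lambda] *)

Lemma leq_card_inj_in {T T' : finType} (f : T -> T') (A : pred T) (B : pred T') :
  {in A &, injective f} -> {in A, forall x, f x \in B} -> (#|A| <= #|B|)%N.
Proof.
move=> f_inj fAB; rewrite -(card_in_image f_inj); apply/subset_leq_card.
by apply/fintype.subsetP => _ /fintype.imageP[x Ax ->]; exact: fAB.
Qed.

Section CountTuples.
Context {n : nat} (b : 'X_{1..n}).
Local Notation tuples k := {ffun 'I_k -> 'X_{1..n < (mdeg b).+1}}.

(** The default [bm0] is never reached on an admissible tuple, whose members have degree at most
    [mdeg b]. *)
Definition tuple_of {k} (T : 'I_k -> 'X_{1..n}) : tuples k :=
  [ffun j => insubd (bm0) (T j)].

Lemma tuple_ofE {k} (T : 'I_k -> 'X_{1..n}) j :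
  admissible b T -> tuple_of T j = T j :> 'X_{1..n}.
Proof. by move=> admT; rewrite ffunE val_insubd (admissible_mdeg admT j). Qed.

Lemma eq_admissible {k} {T U : 'I_k -> 'X_{1..n}} :
  T =1 U -> admissible b T -> admissible b U.
Proof. by move=> /funext ->. Qed.

Lemma lambda_tuple_of {k} (T : 'I_k -> 'X_{1..n}) :
  admissible b T -> lambda_tuple (tuple_of T).
Proof.
by move=> admT; apply/lambda_tupleP/(eq_admissible _ admT) => j; rewrite tuple_ofE.
Qed.

(** The tuples have length [k.+1], so that a last member exists. *)
Definition count_hat0 k : nat := #|[pred T : tuples k.+1 |
  lambda_tuple T && (expo_hat (T ord_max) == 0%MM)]|.

Definition count_hat_neq0 k : nat := #|[pred T : tuples k.+1 |
  lambda_tuple T && (expo_hat (T ord_max) != 0%MM)]|.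

(** Merging and splitting each have the other as a left inverse on the tuples concerned, which gives
    injections both ways. *)
Lemma count_hat0S k : ~~ mult_free b -> count_hat0 k.+1 = count_hat_neq0 k.
Proof.
move=> nmf; apply/eqP; rewrite eqn_leq; apply/andP; split.
- pose f (U : tuples k.+2) := tuple_of (merge_last (fun j => U j : 'X_{1..n})).
  apply: (leq_card_inj_in f) => [U V|U].
  + move=> /andP[/lambda_tupleP aU /eqP hU] /andP[/lambda_tupleP aV /eqP hV] /ffunP fUV.
    apply/ffunP => j; apply: val_inj.
    rewrite /= -[LHS](merge_lastK _ aU hU j) -[RHS](merge_lastK _ aV hV j); congr (split_last _ j).
    apply/funext => l; have /(congr1 val)/= := fUV l.
    by rewrite !tuple_ofE //; apply: admissible_merge.
  + move=> /andP[/lambda_tupleP aU /eqP hU]; have aM := admissible_merge _ aU.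
    rewrite inE lambda_tuple_of // tuple_ofE // (hat_merge_last _ aU hU).
    by have [_ U0 _ _] := aU; exact: U0.
- pose f (T : tuples k.+1) := tuple_of (split_last (fun j => T j : 'X_{1..n})).
  apply: (leq_card_inj_in f) => [T V|T].
  + move=> /andP[/lambda_tupleP aT hT] /andP[/lambda_tupleP aV hV] /ffunP fTV.
    apply/ffunP => j; apply: val_inj.
    rewrite /= -[LHS](split_lastK (fun j => T j : 'X_{1..n}) j).
    rewrite -[RHS](split_lastK (fun j => V j : 'X_{1..n}) j).
    congr (merge_last _ j); apply/funext => l; have /(congr1 val)/= := fTV l.
    by rewrite !tuple_ofE //; apply: admissible_split.
  + move=> /andP[/lambda_tupleP aT hT]; have aS := admissible_split _ nmf aT hT.
    by rewrite inE lambda_tuple_of // tuple_ofE // split_last_max expo_hat_subr eqxx.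
Qed.

Lemma count_hat0_0 : b != 0%MM -> count_hat0 0 = (expo_hat b == 0%MM).
Proof.
move=> b0; have admb : admissible b (fun _ : 'I_1 => b).
  by split => // [i|i j1 j2]; rewrite ?big_ord1 // !ord1 eqxx.
have admE T : lambda_tuple T = (T == tuple_of (fun _ : 'I_1 => b)).
  apply/lambda_tupleP/eqP => [admT|->]; last exact/lambda_tupleP/lambda_tuple_of.
  apply/ffunP => j; apply: val_inj; rewrite /= tuple_ofE //; apply/mnmP => i.
  by have [<- _ _ _] := admT; rewrite big_ord1 ord1.
rewrite /count_hat0; case: eqP => [hb|/eqP hb].
  rewrite -[RHS](card1 (tuple_of (fun _ : 'I_1 => b))); apply: eq_card => T.
  by rewrite !inE admE; case: eqP => //= ->; rewrite tuple_ofE // hb eqxx.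
apply: eq_card0 => T; rewrite !inE admE; case: eqP => //= ->.
by rewrite tuple_ofE // (negPf hb).
Qed.

(** The tuples counted have length [mdeg b + 1], more than their total degree allows. *)
Lemma count_hat0_mdeg : count_hat0 (mdeg b) = 0%N.
Proof.
apply: eq_card0 => T; apply/negP => /andP[/lambda_tupleP/admissible_size].
by rewrite ltnn.
Qed.

Lemma lambda_nmf : ~~ mult_free b -> lambda b = delta b * (expo_hat b == 0%MM)%:R.
Proof.
move=> nmf; have b0 : b != 0%MM.
  by case/mult_freePn: nmf => i bi; apply/mnm_neq0P; exists i; lia.
have termE k : \sum_(T : tuples k | lambda_tuple T) \prod_(j < k) delta (T j) =
    delta b * #|[pred T : tuples k | lambda_tuple T]|%:R.
  rewrite -sum1_card natr_sum mulr_sumr; apply: eq_bigr => T /lambda_tupleP admT.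
  by rewrite mulr1 (admissible_delta admT).
(* The empty tuple has sum 0, hence contributes nothing. *)
rewrite /lambda big_ord_recl /= termE eq_card0 ?mulr0 ?add0r => [|T]; last first.
  apply/negP => /lambda_tupleP[sT _ _ _]; case/mnm_neq0P: b0 => i.
  by rewrite -sT big_ord0.
have splitE k : #|[pred T : tuples k.+1 | lambda_tuple T]| =
    (count_hat0 k + count_hat0 k.+1)%N.
  rewrite count_hat0S // /count_hat0 /count_hat_neq0.
  rewrite -(cardID [pred T : tuples k.+1 | expo_hat (T ord_max) == 0%MM]).
  congr (_ + _)%N; apply: eq_card => T; rewrite !inE //; exact: andbC.
rewrite -count_hat0_0 // -[count_hat0 0]subn0.
(* The index [k] stands for tuples of length [k.+1], whence the sign [(-1) ^+ k.+2]; the boundary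
   term vanishes at [m = mdeg b]. *)
have telescope m : \sum_(k < m) (-1) ^+ k.+2 * (delta b *
    (count_hat0 k + count_hat0 k.+1)%N%:R) =
    delta b * ((count_hat0 0)%:R - (-1) ^+ m * (count_hat0 m)%:R).
  elim: m => [|m IH]; first by rewrite big_ord0 mul1r subrr mulr0.
  by rewrite big_ord_recr /= IH natrD !exprS; ring.
under eq_bigr => k _ do rewrite termE splitE.
by rewrite telescope count_hat0_mdeg mulr0 subr0 subn0.
Qed.

End CountTuples.

Theorem proposition5p4 (k : fieldType) (X Y : proj_variety k)
    (smoothX : smooth X) (smoothY : smooth Y) (pi : finite_covering X Y)
    (n : nat) (R : 'I_n -> set (funfield X))
    (R_inj : injective R) (R_range : range R = ramification_components pi)
    (e : 'I_n -> nat) (eP : forall i, ramification_degree pi (R i) (e i))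
    (a : 'X_{1..n}) (aNMF : ~~ mult_free a)
    (hat_a_ge1 : (1 <= mdeg (expo_hat a))%N) :
  delta a * ((ram_monomial e a)%:R - 1)
  + \sum_(a' : 'X_{1..n < (mdeg (expo_hat a)).+1}
            | (a' <= expo_hat a)%MM && (1 <= mdeg a')%N)
      (- lambda (a - a')%MM * delta a') * ((ram_monomial e a')%:R - 1)
  = delta a * ((ram_monomial e a)%:R - (ram_monomial e (expo_hat a))%:R).
Proof.
(* A coordinate with [a i > 1] is absent from the hat, so [a - a'] keeps it. *)
have nmf a' : (a' <= expo_hat a)%MM -> ~~ mult_free (a - a')%MM.
  move=> /mnm_lepP le_a'; case/mult_freePn: aNMF => i ai; apply/mult_freePn.
  by exists i; have := le_a' i; rewrite mnmBE expo_hatE; lia.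
(* The term [a' = expo_hat a] is isolated; it occurs in the sum because the hat has degree at least
   1. *)
rewrite (bigD1 (BMultinom (ltnSn (mdeg (expo_hat a))))) /= ?lepm_refl //.
rewrite big1 => [|c /andP[/andP[c_le _] c_neq]]; last first.
  rewrite lambda_nmf ?nmf //; case: eqP => [hat0|_]; last first.
    by rewrite mulr0 oppr0 !mul0r.
  (* If [a - c] has zero hat, then [c] is 1 wherever [a] is, so [c] is the excluded [expo_hat a]. *)
  case/eqP: c_neq; apply: val_inj => /=; apply/mnmP => i.
  have /mnmP/(_ i) := hat0; have := mnm_lepP c_le i.
  by rewrite !expo_hatE mnmBE mnm0E; lia.
(* The isolated coefficient is [- delta a], so the two constants [-1] cancel. *)
rewrite lambda_nmf ?nmf ?lepm_refl // expo_hat_subr eqxx mulr1 mulNr delta_hat.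
ring.
Qed.
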